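(* Let $(A,\succ,\prec,\ast)$ be a coherent noncommutative pre-Poisson algebra, $\{e_1,\dots,e_n\}$ a basis of $A$ and $\{e_1^*,\dots,e_n^*\}$ the dual basis of $A^*$. Then $r=\sum_i(e_i\otimes e_i^*-e_i^*\otimes e_i)$ is a skew-symmetric solution of the Poisson Yang-Baxter equation in the coherent noncommutative Poisson algebra $A^c\ltimes_{(-R_\prec^*,-L_\succ^*,L^* )}A^*$.
   Context: All vector spaces are finite dimensional over an algebraically closed field of characteristic $0$. A dendriform algebra $(A,\succ,\prec)$: bilinear operations with $(x\prec y)\prec z=x\prec(y\succ z+y\prec z)$, $(x\succ y)\prec z=x\succ(y\prec z)$, $x\succ(y\succ z)=(x\succ y+x\prec y)\succ z$. A pre-Lie algebra $(A,\ast)$: a bilinear operation with $(x\ast y)\ast z-x\ast(y\ast z)=(y\ast x)\ast z-y\ast(x\ast z)$. A coherent noncommutative pre-Poisson algebra is $(A,\succ,\prec,\ast)$ such that $(A,\succ,\prec)$ is dendriform, $(A,\ast)$ is pre-Lie and, for all $x,y,z\in A$, $(x\ast y-y\ast x)\succ z=x\ast(y\succ z)-y\succ(x\ast z)$, $x\prec(y\ast z-z\ast y)=y\ast(x\prec z)-(y\ast x)\prec z$, $(x\succ y+x\prec y)\ast z=(x\ast z)\prec y+x\succ(y\ast z)$ and $(x\succ y+x\prec y)\ast z=x\ast(y\succ z)+y\ast(z\prec x)$. A noncommutative Poisson algebra is a vector space with an associative (not necessarily commutative) product and a Lie bracket such that $\{x,y\cdot z\}=\{x,y\}\cdot z+y\cdot\{x,z\}$;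 it is coherent if $\{x,y\cdot z\}+\{y,z\cdot x\}+\{z,x\cdot y\}=0$. The sub-adjacent noncommutative Poisson algebra $A^c$ is $A$ with $x\cdot y=x\succ y+x\prec y$, $\{x,y\}=x\ast y-y\ast x$; it is coherent when $A$ is. Let $L_{\succ x}y=x\succ y$, $R_{\prec x}y=y\prec x$, $L_xy=x\ast y$, and for $\mu:A\to\mathfrak{gl}(A)$ let $\langle\mu^*_x\alpha,y\rangle=-\langle\alpha,\mu_xy\rangle$ for $\alpha\in A^*$. Then $A^c\ltimes_{(-R_\prec^*,-L_\succ^*,L^* )}A^*$ is $A\oplus A^*$ with $(x+\alpha)\cdot(y+\beta)=x\cdot y-R^*_{\prec x}\beta-L^*_{\succ y}\alpha$ and $\{x+\alpha,y+\beta\}=\{x,y\}+L^*_x\beta-L^*_y\alpha$; it is a coherent noncommutative Poisson algebra. For a coherent noncommutative Poisson algebra $Q$ and $r=\sum_ia_i\otimes b_i\in Q\otimes Q$, the Poisson Yang-Baxter equation is $\mathbf A(r)=\mathbf C(r)=0$, where $\mathbf A(r)=\sum_{i,j}(a_ia_j\otimes b_i\otimes b_j+a_i\otimes a_j\otimes b_ib_j-a_j\otimes a_ib_j\otimes b_i)$ and $\mathbf C(r)=\sum_{i,j}(\{a_i,a_j\}\otimes b_i\otimes b_j+a_i\otimes\{b_i,a_j\}\otimes b_j+a_i\otimes a_j\otimes\{b_i,b_j\})$. *)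

(* Defs.v *)
From HB Require Import structures.
From mathcomp Require Import all_boot all_order all_algebra.

Set Implicit Arguments.
Unset Strict Implicit.
Unset Printing Implicit Defensive.

Import GRing.Theory.
Local Open Scope ring_scope.

(* The tensor product of two finite-dimensional spaces is modelled by matrices
   of coordinates with respect to the library's chosen bases; tensor_universal
   shows that this is a tensor product. *)
Definition tensor (F : fieldType) (V W : vectType F) : vectType F :=
  'M[F]_(\dim {:V}, \dim {:W}).

Definition tens (F : fieldType) (V W : vectType F) (v : V) (w : W) :
  tensor V W :=
  \matrix_(i, j) (coord (vbasis {:V}) i v * coord (vbasis {:W}) j w).

Notation "v ⊗ w" := (tens v w) (at level 40, left associativity) : ring_scope.

Lemma tens_is_bilinear (F : fieldType) (V W : vectType F) :
  bilinear_for *:%R *:%R (@tens F V W).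
Proof.
split=> [w|v] c x y /=; apply/matrixP => i j; rewrite !mxE linearP /=.
  by rewrite mulrDl mulrA.
by rewrite mulrDr mulrCA.
Qed.

HB.instance Definition _ (F : fieldType) (V W : vectType F) :=
  bilinear_isBilinear.Build F V W (tensor V W) *:%R *:%R (@tens F V W)
    (@tens_is_bilinear F V W).

Lemma tensor_coordE (F : fieldType) (V W : vectType F) (t : tensor V W) :
  t = \sum_i \sum_j
        ((t : 'M[F]_(_, _)) i j *: (vbasis {:V})`_i) ⊗ (vbasis {:W})`_j.
Proof.
rewrite {1}[t]matrix_sum_delta; apply: eq_bigr => i _; apply: eq_bigr => j _.
rewrite linearZl_LR /=; congr (_ *: _); apply/matrixP => k l.
rewrite !mxE !coord_free ?(basis_free (vbasisP _)) //.
by rewrite -natrM mulnb ![_ == i]eq_sym ![_ == j]eq_sym.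
Qed.

Lemma tensor_generated (F : fieldType) (V W : vectType F) (t : tensor V W) :
  exists (m : nat) (a : 'I_m -> V) (b : 'I_m -> W), t = \sum_i a i ⊗ b i.
Proof.
pose I : finType := ('I_(\dim {:V}) * 'I_(\dim {:W}))%type.
pose k (p : 'I_#|I|) : I := enum_val p.
exists #|I|, (fun p => (t : 'M[F]_(_, _)) (k p).1 (k p).2 *: (vbasis {:V})`_(k p).1).
exists (fun p => (vbasis {:W})`_(k p).2).
rewrite {1}(tensor_coordE t) pair_big /=.
by rewrite (reindex k) //=; apply/onW_bij/enum_val_bij.
Qed.

Lemma tensor_universal (F : fieldType) (U V W : vectType F)
    (f : {bilinear V -> W -> U}) :
  exists! g : 'Hom(tensor V W, U), forall v w, g (v ⊗ w) = f v w.
Proof.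
pose h (t : tensor V W) : U := \sum_i \sum_j
  (t : 'M[F]_(_, _)) i j *: f (vbasis {:V})`_i (vbasis {:W})`_j.
have hl : linear h.
  move=> c x y; rewrite /h scaler_sumr -big_split; apply: eq_bigr => i _ /=.
  rewrite scaler_sumr -big_split; apply: eq_bigr => j _ /=.
  by rewrite !mxE scalerDl scalerA.
pose H : {linear tensor V W -> U} :=
  HB.pack h (GRing.isLinear.Build _ _ _ _ h hl).
exists (linfun H); split=> [v w|g gE].
  rewrite lfunE /= /h.
  rewrite [in RHS](coord_vbasis (memvf v)) [in RHS](coord_vbasis (memvf w)).
  rewrite linear_sumlz; apply: eq_bigr => i _ /=.
  rewrite linear_sumr; apply: eq_bigr => j _ /=.
  by rewrite linearZr_LR linearZl_LR /= scalerA !mxE mulrC.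
apply/lfunP => t; rewrite lfunE /= [in RHS](tensor_coordE t) linear_sum.
apply: eq_bigr => i _; rewrite linear_sum; apply: eq_bigr => j _ /=.
by rewrite gE linearZl_LR.
Qed.

Definition tensor_flip (F : fieldType) (V W : vectType F)
  (t : tensor V W) : tensor W V := (t : 'M[F]_(_, _))^T.

Lemma tensor_flipE (F : fieldType) (V W : vectType F) (v : V) (w : W) :
  tensor_flip (v ⊗ w) = w ⊗ v.
Proof. by apply/matrixP => i j; rewrite !mxE mulrC. Qed.

Definition skew_symmetric (F : fieldType) (V : vectType F) (r : tensor V V) :=
  tensor_flip r = - r.

Record dendriform (F : fieldType) (A : vectType F)
    (succ prec : {bilinear A -> A -> A}) : Prop := Dendriform {
  dendriform_prec : forall x y z,
    prec (prec x y) z = prec x (succ y z + prec y z);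
  dendriform_mid : forall x y z, prec (succ x y) z = succ x (prec y z);
  dendriform_succ : forall x y z,
    succ x (succ y z) = succ (succ x y + prec x y) z
}.

Definition pre_lie (F : fieldType) (A : vectType F)
    (ast : {bilinear A -> A -> A}) : Prop := forall x y z,
  ast (ast x y) z - ast x (ast y z) = ast (ast y x) z - ast y (ast x z).

Record coherent_nc_pre_poisson (F : fieldType) (A : vectType F)
    (succ prec ast : {bilinear A -> A -> A}) : Prop := CoherentNcPrePoisson {
  pre_poisson_dendriform : dendriform succ prec;
  pre_poisson_pre_lie : pre_lie ast;
  pre_poisson_succ : forall x y z,
    succ (ast x y - ast y x) z = ast x (succ y z) - succ y (ast x z);
  pre_poisson_prec : forall x y z,
    prec x (ast y z - ast z y) = ast y (prec x z) - prec (ast y x) z;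
  pre_poisson_mul : forall x y z,
    ast (succ x y + prec x y) z = prec (ast x z) y + succ x (ast y z);
  pre_poisson_coherent : forall x y z,
    ast (succ x y + prec x y) z = ast x (succ y z) + ast y (prec z x)
}.

Record nc_poisson (F : fieldType) (Q : vectType F)
    (mul br : {bilinear Q -> Q -> Q}) : Prop := NcPoisson {
  poisson_mulA : forall x y z, mul (mul x y) z = mul x (mul y z);
  poisson_brxx : forall x, br x x = 0;
  poisson_jacobi : forall x y z,
    br x (br y z) + br y (br z x) + br z (br x y) = 0;
  poisson_leibniz : forall x y z,
    br x (mul y z) = mul (br x y) z + mul y (br x z)
}.

Record coherent_nc_poisson (F : fieldType) (Q : vectType F)
    (mul br : {bilinear Q -> Q -> Q}) : Prop := CoherentNcPoisson {
  coherent_nc_poisson_nc_poisson : nc_poisson mul br;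
  coherent_nc_poisson_coherent : forall x y z,
    br x (mul y z) + br y (mul z x) + br z (mul x y) = 0
}.

Definition sub_adjacent_mul (F : fieldType) (A : vectType F)
  (succ prec : {bilinear A -> A -> A}) (x y : A) : A := succ x y + prec x y.

Definition sub_adjacent_br (F : fieldType) (A : vectType F)
  (ast : {bilinear A -> A -> A}) (x y : A) : A := ast x y - ast y x.

Definition dual (F : fieldType) (A : vectType F) : vectType F := 'Hom(A, F^o).

(* Given mu_x : A -> A, this is mu_x^*, with <mu_x^* a, y> = - <a, mu_x y>. *)
Definition dual_act (F : fieldType) (A : vectType F) (mux : 'End(A))
  (a : dual A) : dual A := - (a \o mux)%VF.

Definition lmul (F : fieldType) (A : vectType F) (op : {bilinear A -> A -> A})
  (x : A) : 'End(A) := linfun (op x).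

Definition rmul (F : fieldType) (A : vectType F) (op : {bilinear A -> A -> A})
  (x : A) : 'End(A) := linfun (applyr op x).

Lemma dual_actE (F : fieldType) (A : vectType F) (mux : 'End(A)) (a : dual A)
  (y : A) : dual_act mux a y = - a (mux y).
Proof. by rewrite /dual_act opp_lfunE comp_lfunE. Qed.

Lemma lmulE (F : fieldType) (A : vectType F) (op : {bilinear A -> A -> A})
  (x y : A) : lmul op x y = op x y.
Proof. by rewrite lfunE. Qed.

Lemma rmulE (F : fieldType) (A : vectType F) (op : {bilinear A -> A -> A})
  (x y : A) : rmul op x y = op y x.
Proof. by rewrite lfunE. Qed.

Definition semidirect (F : fieldType) (A : vectType F) : vectType F :=
  (A * dual A)%type.

Definition semidirect_mul (F : fieldType) (A : vectType F)
  (succ prec : {bilinear A -> A -> A}) (u v : semidirect A) : semidirect A :=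
  (sub_adjacent_mul succ prec u.1 v.1,
   - dual_act (rmul prec u.1) v.2 - dual_act (lmul succ v.1) u.2).

Definition semidirect_br (F : fieldType) (A : vectType F)
  (ast : {bilinear A -> A -> A}) (u v : semidirect A) : semidirect A :=
  (sub_adjacent_br ast u.1 v.1,
   dual_act (lmul ast u.1) v.2 - dual_act (lmul ast v.1) u.2).

Lemma semidirect_mul_is_bilinear (F : fieldType) (A : vectType F)
    (succ prec : {bilinear A -> A -> A}) :
  bilinear_for *:%R *:%R (semidirect_mul succ prec).
Proof.
split=> [[z c]|[z c]] k [x a] [y b]; apply: injective_projections => /=.
- by rewrite /sub_adjacent_mul !linearPl /= scalerDr addrACA.
- apply/lfunP => t.
  rewrite !(add_lfunE, opp_lfunE, scale_lfunE, dual_actE, lmulE, rmulE) /=.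
  rewrite linearPr [c _]linearP /=.
  by rewrite !(comp_lfunE, lmulE, rmulE, scalerN, opprD, opprK) scalerDr ?scalerN addrACA.
- by rewrite /sub_adjacent_mul !linearPr /= scalerDr addrACA.
- apply/lfunP => t.
  rewrite !(add_lfunE, opp_lfunE, scale_lfunE, dual_actE, lmulE, rmulE) /=.
  rewrite linearPl [c _]linearP /=.
  by rewrite !(comp_lfunE, lmulE, rmulE, scalerN, opprD, opprK) scalerDr ?scalerN addrACA.
Qed.

HB.instance Definition _ (F : fieldType) (A : vectType F)
    (succ prec : {bilinear A -> A -> A}) :=
  bilinear_isBilinear.Build F (semidirect A) (semidirect A) (semidirect A)
    *:%R *:%R (semidirect_mul succ prec) (semidirect_mul_is_bilinear succ prec).

Lemma semidirect_br_is_bilinear (F : fieldType) (A : vectType F)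
    (ast : {bilinear A -> A -> A}) :
  bilinear_for *:%R *:%R (semidirect_br ast).
Proof.
split=> [[z c]|[z c]] k [x a] [y b]; apply: injective_projections => /=.
- by rewrite /sub_adjacent_br linearPl linearPr /= scalerBr opprD addrACA.
- apply/lfunP => t.
  rewrite !(add_lfunE, opp_lfunE, scale_lfunE, dual_actE, lmulE, rmulE) /=.
  rewrite linearPl [c _]linearP /=.
  by rewrite !(comp_lfunE, lmulE, rmulE, scalerN, opprD, opprK) scalerDr ?scalerN addrACA.
- by rewrite /sub_adjacent_br linearPl linearPr /= scalerBr opprD addrACA.
- apply/lfunP => t.
  rewrite !(add_lfunE, opp_lfunE, scale_lfunE, dual_actE, lmulE, rmulE) /=.
  rewrite linearPl [c _]linearP /=.
  by rewrite !(comp_lfunE, lmulE, rmulE, scalerN, opprD, opprK) scalerDr ?scalerN addrACA.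
Qed.

HB.instance Definition _ (F : fieldType) (A : vectType F)
    (ast : {bilinear A -> A -> A}) :=
  bilinear_isBilinear.Build F (semidirect A) (semidirect A) (semidirect A)
    *:%R *:%R (semidirect_br ast) (semidirect_br_is_bilinear ast).

Definition assoc_YB (F : fieldType) (Q : vectType F)
    (mul : {bilinear Q -> Q -> Q}) (m : nat) (a b : 'I_m -> Q) :
  tensor (tensor Q Q) Q :=
  \sum_i \sum_j (mul (a i) (a j) ⊗ b i ⊗ b j + a i ⊗ a j ⊗ mul (b i) (b j)
                 - a j ⊗ mul (a i) (b j) ⊗ b i).

Definition classical_YB (F : fieldType) (Q : vectType F)
    (br : {bilinear Q -> Q -> Q}) (m : nat) (a b : 'I_m -> Q) :
  tensor (tensor Q Q) Q :=
  \sum_i \sum_j (br (a i) (a j) ⊗ b i ⊗ b j + a i ⊗ br (b i) (a j) ⊗ b j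
                 + a i ⊗ a j ⊗ br (b i) (b j)).

(* A(r) and C(r) are given by a presentation r = \sum_i a_i ⊗ b_i, on which they
   do not depend; they are required to vanish for every presentation of r, and
   at least one exists by tensor_generated. *)
Definition poisson_YBE (F : fieldType) (Q : vectType F)
    (mul br : {bilinear Q -> Q -> Q}) (r : tensor Q Q) : Prop :=
  forall (m : nat) (a b : 'I_m -> Q), r = \sum_i a i ⊗ b i ->
    assoc_YB mul a b = 0 /\ classical_YB br a b = 0.

Definition incl_alg (F : fieldType) (A : vectType F) (x : A) : semidirect A :=
  (x, 0).

Definition incl_dual (F : fieldType) (A : vectType F) (a : dual A) :
  semidirect A := (0, a).

Definition dual_basis (F : fieldType) (A : vectType F) (n : nat)
  (e : n.-tuple A) (i : 'I_n) : dual A := linfun (coord e i : A -> F^o).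

Lemma dual_basisE (F : fieldType) (A : vectType F) (n : nat) (e : n.-tuple A)
    (i j : 'I_n) :
  basis_of {:A} e -> dual_basis e i (tnth e j) = (i == j)%:R.
Proof.
move=> /basis_free e_free.
by rewrite lfunE /= (tnth_nth 0) coord_free // eq_sym.
Qed.

(* Main.v *)
(* On Q = A ⊕ A^* both products have the following shape: for some l_x, r_x in
   End(A), x y = l_x y + r_y x, x c = c \o r_x and c x = c \o l_x for x, y in A
   and c in A^*, and A^* A^* = 0: (l, r) = (L_succ, R_prec) for the associative
   product, (L_ast, - L_ast) for the bracket. Since the bracket is antisymmetric,
   C(r) is A(r) computed with the bracket, so both equations are instances of
   A(r) = 0. In that equation the identity
   \sum_i f(e_i) ⊗ e_i^* = \sum_i e_i ⊗ (e_i^* \o f)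
   moves every operator onto the factor in A, after which the terms cancel
   pairwise; no axiom of A is used there. The axioms only enter in the fact that
   Q is a coherent noncommutative Poisson algebra. *)
From HB Require Import structures.
Require Import Defs.
From mathcomp Require Import all_boot all_order all_algebra.
From mathcomp Require Import ring.
Import GRing.Theory.
Set Implicit Arguments.
Unset Strict Implicit.
Local Open Scope ring_scope.

(** * The semidirect product is a coherent noncommutative Poisson algebra *)

Section Poisson.
Variables (F : fieldType) (A : vectType F).

(** Coordinates are linear forms. Pairing an identity of [A] with an arbitrary form makes it an
    identity of scalars, where [ring] applies. *)
Lemma dual_separates (x y : A) : (forall a : dual A, a x = a y) -> x = y.
Proof.
move=> xy; rewrite (coord_vbasis (memvf x)) (coord_vbasis (memvf y)).
apply: eq_bigr => i _; congr (_ *: _).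
by have := xy (dual_basis (vbasis {:A}) i); rewrite !lfunE.
Qed.

Variables (succ prec ast : {bilinear A -> A -> A}).

Lemma semidirect_mul_dualE (u v : semidirect A) (t : A) :
  (semidirect_mul succ prec u v).2 t = v.2 (prec t u.1) + u.2 (succ v.1 t).
Proof.
by rewrite /= /dual_act !opprK add_lfunE !comp_lfunE lmulE rmulE.
Qed.

Lemma semidirect_br_dualE (u v : semidirect A) (t : A) :
  (semidirect_br ast u v).2 t = u.2 (ast v.1 t) - v.2 (ast u.1 t).
Proof.
by rewrite /= /dual_act opprK addrC add_lfunE opp_lfunE !comp_lfunE !lmulE.
Qed.

Lemma semidirect_add_dualE (u v : semidirect A) (t : A) :
  (u + v).2 t = u.2 t + v.2 t.
Proof. exact: add_lfunE. Qed.

Let dualE :=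
  (semidirect_mul_dualE, semidirect_br_dualE, semidirect_add_dualE).

Hypothesis hA : coherent_nc_pre_poisson succ prec ast.

(** Each axiom is checked on the [A]-component and on the dual component evaluated at [t].
    Associativity uses the dendriform axioms in both, Jacobi the pre-Lie identity. The last two
    pre-Poisson axioms trade places: Leibniz needs [pm] on [A] and [pc] on the dual, coherence the
    reverse. *)
Lemma semidirect_coherent :
  coherent_nc_poisson (semidirect_mul succ prec) (semidirect_br ast).
Proof.
have [[dp dm ds] pl ps pp pm pc] := hA.
(* The pre-Lie identity says that left multiplication represents the commutator bracket. *)
have brE x y z : ast (ast x y - ast y x) z = ast x (ast y z) - ast y (ast x z).
  rewrite linearBl; have /eqP := pl x y z; rewrite subr_eq => /eqP ->.
  by rewrite addrC -addrA addKr addrC.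
do 2?split.
- move=> u v w; apply: injective_projections.
    rewrite /= /sub_adjacent_mul [prec (_ + _) _]linearDl.
    by rewrite [succ _ (_ + _)]linearDr /= dm dp ds addrA.
  apply/lfunP => t; rewrite !semidirect_mul_dualE /= /sub_adjacent_mul.
  by rewrite dp dm ds addrA.
- move=> u; apply: injective_projections => /=.
    by rewrite /sub_adjacent_br subrr.
  by apply/lfunP => t; rewrite semidirect_br_dualE zero_lfunE subrr.
- move=> u v w; apply: injective_projections.
    rewrite /= /sub_adjacent_br !brE.
    apply: dual_separates => a; rewrite !(linearD, linearN) linear0 /=; ring.
  apply/lfunP => t; rewrite !dualE !brE /=.
  rewrite !(linearD, linearN) zero_lfunE /=; ring.
- move=> u v w; apply: injective_projections.
    rewrite /= /sub_adjacent_br /sub_adjacent_mul pm ps pp.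
    rewrite [prec (_ - _) _]linearBl /=.
    apply: dual_separates => a; rewrite !(linearD, linearN) /=; ring.
  apply/lfunP => t; rewrite !dualE.
  rewrite /= /sub_adjacent_br /sub_adjacent_mul ps pp pc.
  rewrite !(linearD, linearN) /=; ring.
- move=> u v w; apply: injective_projections.
    rewrite /= /sub_adjacent_br /sub_adjacent_mul !pc.
    apply: dual_separates => a; rewrite !(linearD, linearN) linear0 /=; ring.
  apply/lfunP => t; rewrite !dualE.
  rewrite /= /sub_adjacent_br /sub_adjacent_mul !pm !linearD zero_lfunE /=; ring.
Qed.
End Poisson.

(** * Independence of the presentation of a tensor *)

Local Notation is_bilinear := (bilinear_for *:%R *:%R).

(** By the universal property, [f] factors through a linear map on the tensor product, which is
    applied to both presentations. *)
Lemma eq_sum_tens (F : fieldType) (V W U : vectType F) (I J : finType)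
    (a : I -> V) (b : I -> W) (a' : J -> V) (b' : J -> W) (f : V -> W -> U) :
  is_bilinear f -> \sum_i a i ⊗ b i = \sum_j a' j ⊗ b' j ->
  \sum_i f (a i) (b i) = \sum_j f (a' j) (b' j).
Proof.
move=> fl eq_ab.
pose g : {bilinear V -> W -> U} :=
  HB.pack f (bilinear_isBilinear.Build F V W U *:%R *:%R f fl).
have [h [hE _]] := tensor_universal g.
have := congr1 h eq_ab; rewrite !linear_sum /=.
by under eq_bigr do rewrite hE; under [X in _ = X -> _]eq_bigr do rewrite hE.
Qed.

(** The presentation is changed in one pair of arguments at a time: first in the inner sum, then,
    after exchanging the sums, in the other. *)
Lemma eq_sum2_tens (F : fieldType) (V W U : vectType F) (I J : finType)
    (a : I -> V) (b : I -> W) (a' : J -> V) (b' : J -> W)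
    (f : V -> W -> V -> W -> U) :
  (forall x y, is_bilinear (f x y)) ->
  (forall x y, is_bilinear (fun x' y' => f x' y' x y)) ->
  \sum_i a i ⊗ b i = \sum_j a' j ⊗ b' j ->
  \sum_i \sum_k f (a i) (b i) (a k) (b k)
    = \sum_j \sum_k f (a' j) (b' j) (a' k) (b' k).
Proof.
move=> fr fl eq_ab.
under eq_bigr do rewrite (eq_sum_tens (fr _ _) eq_ab).
rewrite exchange_big /= [RHS]exchange_big; apply: eq_bigr => k _.
exact: eq_sum_tens (fl _ _) eq_ab.
Qed.

(** * Dual bases, transposes, and the inclusions of [A] and its dual *)

Section Dual.
Variables (F : fieldType) (A U : vectType F) (n : nat) (e : n.-tuple A).
Hypothesis he : basis_of {:A} e.
Let d := dual_basis e.

Lemma dual_basis_transpose (g : A -> dual A -> U) (f : 'End(A)) :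
  is_bilinear g ->
  \sum_i g (f (tnth e i)) (d i) = \sum_i g (tnth e i) (d i \o f)%VF.
Proof.
move=> gl.
pose h : {bilinear A -> dual A -> U} :=
  HB.pack g (bilinear_isBilinear.Build F A (dual A) U *:%R *:%R g gl).
(* The matrix of [f] in the basis [e]. It expands [f] of a basis vector along its columns and the
   transpose of a dual basis vector along its rows, so both sides become the same double sum. *)
pose c k i := d k (f (tnth e i)).
have vE x : x = \sum_k d k x *: tnth e k.
  rewrite {1}(coord_basis he (memvf x)); apply: eq_bigr => k _.
  by rewrite lfunE (tnth_nth 0).
have dE k : (d k \o f)%VF = \sum_i c k i *: d i.
  apply/lfunP => x; rewrite comp_lfunE sum_lfunE {1}(vE x) !linear_sum /=.
  apply: eq_bigr => i _.
  by rewrite scale_lfunE !linearZ /= /GRing.scale /= mulrC.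
transitivity (\sum_i \sum_k c k i *: h (tnth e k) (d i)).
  apply: eq_bigr => i _; rewrite -[g _ _]/(h _ _) {1}[f _]vE linear_sumlz.
  by apply: eq_bigr => k _; rewrite linearZl_LR.
rewrite exchange_big; apply: eq_bigr => k _ /=.
rewrite -[RHS]/(h _ _) dE linear_sumr.
by apply: eq_bigr => i _; rewrite linearZr_LR.
Qed.
End Dual.

Lemma incl_alg_is_linear (F : fieldType) (A : vectType F) :
  linear (@incl_alg F A).
Proof.
by move=> k x y; apply: injective_projections; rewrite //= scaler0 addr0.
Qed.

HB.instance Definition _ (F : fieldType) (A : vectType F) :=
  GRing.isLinear.Build F A (semidirect A) _ (@incl_alg F A)
    (@incl_alg_is_linear F A).

Lemma incl_dual_is_linear (F : fieldType) (A : vectType F) :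
  linear (@incl_dual F A).
Proof.
by move=> k x y; apply: injective_projections; rewrite //= scaler0 addr0.
Qed.

HB.instance Definition _ (F : fieldType) (A : vectType F) :=
  GRing.isLinear.Build F (dual A) (semidirect A) _ (@incl_dual F A)
    (@incl_dual_is_linear F A).

(** * The equation A(r) = 0 for a product given by two families of operators *)

Section YangBaxter.
Variables (F : fieldType) (A : vectType F) (n : nat) (e : n.-tuple A).
Hypothesis he : basis_of {:A} e.
Let Q := semidirect A.
Let E i : Q := incl_alg (tnth e i).
Let D i : Q := incl_dual (dual_basis e i).
(** Doubling the index set presents the difference as one sum of pure tensors, with the minus sign
    carried by [b]. *)
Let a (s : 'I_n + 'I_n) : Q := match s with inl i => E i | inr i => D i end.
Let b (s : 'I_n + 'I_n) : Q := match s with inl i => D i | inr i => - E i end.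

Variables (mul : {bilinear Q -> Q -> Q}) (l r : A -> 'End(A)).
Hypothesis mul_alg : forall x y,
  mul (incl_alg x) (incl_alg y) = incl_alg (l x y + r y x).
Hypothesis mul_alg_dual : forall x c,
  mul (incl_alg x) (incl_dual c) = incl_dual (c \o r x)%VF.
Hypothesis mul_dual_alg : forall c x,
  mul (incl_dual c) (incl_alg x) = incl_dual (c \o l x)%VF.
Hypothesis mul_dual : forall c c', mul (incl_dual c) (incl_dual c') = 0.

Let T x y x' y' : tensor (tensor Q Q) Q :=
  mul x x' ⊗ y ⊗ y' + x ⊗ x' ⊗ mul y y' - x' ⊗ mul x y' ⊗ y.

(** The double sum splits into four blocks with values P, - S - P + M, - M and S, where P, M and S
    have the operator in the first, second and third tensor factor. *)
Lemma assoc_YB_canonical : \sum_s \sum_t T (a s) (b s) (a t) (b t) = 0.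
Proof.
pose sum2 (f : 'I_n -> 'I_n -> tensor (tensor Q Q) Q) := \sum_i \sum_j f i j.
have sum2E f g : f =2 g -> \sum_i \sum_j f i j = sum2 g.
  by move=> fg; apply: eq_bigr => i _; apply: eq_bigr => j _.
have sum2D f g : sum2 (fun i j => f i j + g i j) = sum2 f + sum2 g.
  by rewrite /sum2 -big_split; apply: eq_bigr => i _; rewrite big_split.
have sum2N f : sum2 (fun i j => - f i j) = - sum2 f.
  by rewrite /sum2 -sumrN; apply: eq_bigr => i _; rewrite sumrN.
have flip f : sum2 f = sum2 (fun i j => f j i) by exact: exchange_big.
(* For each fixed [j], the transpose identity is applied to the operator [f (tnth e j)]; the indices
   are then renamed. *)
have transp (f : A -> 'End(A)) g : (forall j, is_bilinear (g j)) ->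
    sum2 (fun i j => g j (tnth e i) (dual_basis e i \o f (tnth e j))%VF)
    = sum2 (fun i j => g i (f (tnth e i) (tnth e j)) (dual_basis e j)).
  move=> gl; rewrite flip; apply: eq_bigr => j _.
  by rewrite (dual_basis_transpose he _ (gl j)).
pose c := dual_basis e.
pose v := tnth e.
have sumEE : \sum_i \sum_j T (E i) (D i) (E j) (D j)
    = sum2 (fun i j => incl_alg (l (v i) (v j)) ⊗ D i ⊗ D j).
  rewrite (sum2E _ (fun i j => incl_alg (l (v i) (v j)) ⊗ D i ⊗ D j
      + incl_alg (r (v j) (v i)) ⊗ D i ⊗ D j
      - E j ⊗ incl_dual (c j \o r (v i))%VF ⊗ D i)); last first.
    move=> i j; rewrite /T mul_alg mul_alg_dual mul_dual linear0r addr0.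
    by rewrite !(linearD, linearDl) /=.
  rewrite !sum2D sum2N [X in _ - X]flip [X in _ + X - _]flip.
  (* Transposing the last term turns it into the [r]-part of the first, so only the [l]-part is
     left. *)
  rewrite (transp r (fun j x c => incl_alg x ⊗ incl_dual c ⊗ D j)) ?addrK //.
  by move=> j; split=> z k p q /=; rewrite !(linearP, linearPl, linearPr).
pose M := sum2 (fun i j => D j ⊗ incl_alg (l (v i) (v j)) ⊗ D i)
  + sum2 (fun i j => D i ⊗ incl_alg (r (v i) (v j)) ⊗ D j).
pose S := sum2 (fun i j => D j ⊗ D i ⊗ incl_alg (r (v i) (v j))).
have sumED : \sum_i \sum_j T (E i) (D i) (D j) (- E j)
    = - S - sum2 (fun i j => incl_alg (l (v i) (v j)) ⊗ D i ⊗ D j) + M.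
  rewrite (sum2E _ (fun i j => - (incl_dual (c j \o r (v i))%VF ⊗ D i ⊗ E j)
      - E i ⊗ D j ⊗ incl_dual (c i \o l (v j))%VF
      + (D j ⊗ incl_alg (l (v i) (v j)) ⊗ D i
        + D j ⊗ incl_alg (r (v j) (v i)) ⊗ D i))); last first.
    move=> i j; rewrite /T !(linearNl, linearNr) /=.
    rewrite mul_alg mul_alg_dual mul_dual_alg.
    by rewrite !(linearD, linearDl, linearDr, linearNl, linearNr) /= !opprK.
  rewrite !sum2D !sum2N [sum2 (fun i j => incl_dual _ ⊗ _ ⊗ _)]flip.
  rewrite [sum2 (fun i j => D j ⊗ incl_alg (r _ _) ⊗ _)]flip.
  rewrite (transp r (fun j x c => incl_dual c ⊗ D j ⊗ incl_alg x)).
    rewrite (transp l (fun j x c => incl_alg x ⊗ D j ⊗ incl_dual c)) //.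
    by move=> j; split=> z k p q /=; rewrite !(linearP, linearPl, linearPr).
  by move=> j; split=> z k p q /=; rewrite !(linearP, linearPl, linearPr).
have sumDE : \sum_i \sum_j T (D i) (- E i) (E j) (D j) = - M.
  rewrite (sum2E _ (fun i j => - (incl_dual (c i \o l (v j))%VF ⊗ E i ⊗ D j)
      - D i ⊗ E j ⊗ incl_dual (c j \o r (v i))%VF)); last first.
    move=> i j; rewrite /T mul_dual_alg mul_dual !(linearNl, linearNr) /=.
    rewrite mul_alg_dual.
    by rewrite !(linear0l, linear0r, linearNl, linearNr) /= !oppr0 addr0.
  rewrite !sum2D !sum2N [X in _ - X]flip opprD.
  rewrite (transp l (fun j x c => incl_dual c ⊗ incl_alg x ⊗ D j)).
    rewrite (transp r (fun j x c => D j ⊗ incl_alg x ⊗ incl_dual c)) //.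
    by move=> j; split=> z k p q /=; rewrite !(linearP, linearPl, linearPr).
  by move=> j; split=> z k p q /=; rewrite !(linearP, linearPl, linearPr).
have sumDD : \sum_i \sum_j T (D i) (- E i) (D j) (- E j) = S.
  rewrite (sum2E _ (fun i j => D i ⊗ D j ⊗ incl_alg (r (v j) (v i))
      + D i ⊗ D j ⊗ incl_alg (l (v i) (v j))
      - D j ⊗ incl_dual (c i \o l (v j))%VF ⊗ E i)); last first.
    move=> i j; rewrite /T mul_dual !(linearNl, linearNr) /=.
    rewrite mul_dual_alg mul_alg.
    rewrite !(linear0l, linear0r, linearNl, linearNr) /= !opprK.
    by rewrite add0r [l _ _ + _]addrC linearD linearDr.
  rewrite !sum2D sum2N [X in X + _ - _]flip.
  (* Here the [l]-parts cancel and the [r]-part remains. *)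
  rewrite (transp l (fun j x c => D j ⊗ incl_dual c ⊗ incl_alg x)) ?addrK //.
  by move=> j; split=> z k p q /=; rewrite !(linearP, linearPl, linearPr).
rewrite big_sumType /=.
under eq_bigr do rewrite big_sumType /=.
under [X in _ + X = _]eq_bigr do rewrite big_sumType /=.
rewrite !big_split /= sumEE sumED sumDE sumDD.
by clearbody M S; rewrite [- S - _]addrC -!addrA !addNKr addNr.
Qed.

(** The summand [T] is bilinear in each of its two pairs of arguments, so the value found on the
    canonical presentation holds on every other one. *)
Lemma assoc_YB_semidirect (m : nat) (x y : 'I_m -> Q) :
  \sum_(i < n) (E i ⊗ D i - D i ⊗ E i) = \sum_i x i ⊗ y i ->
  assoc_YB mul x y = 0.
Proof.
have -> : \sum_(i < n) (E i ⊗ D i - D i ⊗ E i) = \sum_s a s ⊗ b s.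
  rewrite big_sumType sumrB -sumrN; congr (_ + _).
  by apply: eq_bigr => i _; rewrite linearNr.
move=> /esym eq_xy.
rewrite /assoc_YB (eq_sum2_tens (f := T) _ _ eq_xy).
- exact: assoc_YB_canonical.
- move=> p q; split=> z k u v /=; rewrite /T !(linearPl, linearPr) /= opprD.
    by rewrite [X in X + _ = _]addrACA [LHS]addrACA !scalerDr scalerN.
  by rewrite [X in X + _ = _]addrACA [LHS]addrACA !scalerDr scalerN.
- move=> p q; split=> z k u v /=; rewrite /T !(linearPl, linearPr) /= opprD.
    by rewrite [X in X + _ = _]addrACA [LHS]addrACA !scalerDr scalerN.
  by rewrite [X in X + _ = _]addrACA [LHS]addrACA !scalerDr scalerN.
Qed.
End YangBaxter.

(** * Reduction of C(r) to A(r), and the conclusion *)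

Lemma classical_YB_antisymmetric (F : fieldType) (Q : vectType F)
    (br : {bilinear Q -> Q -> Q}) (m : nat) (a b : 'I_m -> Q) :
  (forall u v, br u v = - br v u) -> classical_YB br a b = assoc_YB br a b.
Proof.
move=> brC; rewrite /classical_YB /assoc_YB.
under eq_bigr do rewrite !big_split /=.
under [RHS]eq_bigr do rewrite !big_split /=.
rewrite !big_split /= addrAC; congr (_ + _).
(* Only the middle terms differ: swapping [i] and [j] aligns their outer factors, and antisymmetry
   supplies the sign. *)
rewrite exchange_big; apply: eq_bigr => i _; apply: eq_bigr => j _.
by rewrite brC linearNr linearNl.
Qed.

Unset Implicit Arguments.

Theorem corollary5p25 (F : closedFieldType) (charF : [pchar F] =i pred0)
    (A : vectType F) (succ prec ast : {bilinear A -> A -> A})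
    (hA : coherent_nc_pre_poisson succ prec ast)
    (n : nat) (e : n.-tuple A) (he : basis_of {:A} e) :
  let r : tensor (semidirect A) (semidirect A) :=
    \sum_(i < n) (incl_alg (tnth e i) ⊗ incl_dual (dual_basis e i)
                  - incl_dual (dual_basis e i) ⊗ incl_alg (tnth e i)) in
  [/\ coherent_nc_poisson (semidirect_mul succ prec) (semidirect_br ast),
      skew_symmetric r
    & poisson_YBE (semidirect_mul succ prec) (semidirect_br ast) r].
Proof.
split=> [||m a b rE]; first exact: semidirect_coherent.
  rewrite /skew_symmetric /tensor_flip linear_sum -sumrN; apply: eq_bigr => i _.
  by rewrite linearB /= opprB; congr (_ - _); exact: tensor_flipE.
have dual_ext (u v : semidirect A) :
    u.1 = v.1 -> (forall t, u.2 t = v.2 t) -> u = v.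
  by move=> uv1 uv2; apply: injective_projections => //; apply/lfunP.
(* Antisymmetry of the bracket becomes the third goal, after A(r) = 0 for the product and for the
   bracket. *)
split; last rewrite classical_YB_antisymmetric.
- apply: (assoc_YB_semidirect he (l := lmul succ) (r := rmul prec)) rE.
  + move=> x y; apply: dual_ext => [|t].
      by rewrite /= lmulE rmulE.
    by rewrite semidirect_mul_dualE !zero_lfunE addr0.
  + move=> x c; apply: dual_ext => [|t].
      by rewrite /= /sub_adjacent_mul !linear0r addr0.
    by rewrite semidirect_mul_dualE comp_lfunE rmulE zero_lfunE addr0.
  + move=> c x; apply: dual_ext => [|t].
      by rewrite /= /sub_adjacent_mul !linear0l addr0.
    by rewrite semidirect_mul_dualE comp_lfunE lmulE zero_lfunE add0r.
  + move=> c c'; apply: dual_ext => [|t].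
      by rewrite /= /sub_adjacent_mul !linear0l addr0.
    by rewrite semidirect_mul_dualE /= linear0l linear0r !linear0 addr0 zero_lfunE.
- apply: (assoc_YB_semidirect he (l := lmul ast) (r := fun x => - lmul ast x)) rE.
  + move=> x y; apply: dual_ext => [|t].
      by rewrite /= opp_lfunE !lmulE.
    by rewrite semidirect_br_dualE !zero_lfunE subr0.
  + move=> x c; apply: dual_ext => [|t].
      by rewrite /= /sub_adjacent_br !(linear0l, linear0r) subrr.
    rewrite semidirect_br_dualE comp_lfunE opp_lfunE lmulE zero_lfunE.
    by rewrite add0r linearN.
  + move=> c x; apply: dual_ext => [|t].
      by rewrite /= /sub_adjacent_br !(linear0l, linear0r) subrr.
    by rewrite semidirect_br_dualE comp_lfunE lmulE zero_lfunE subr0.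
  + move=> c c'; apply: dual_ext => [|t].
      by rewrite /= /sub_adjacent_br !(linear0l, linear0r) subrr.
    by rewrite semidirect_br_dualE /= !linear0l !linear0 addr0 zero_lfunE.
- move=> u v; apply: dual_ext => [|t]; first by rewrite /= /sub_adjacent_br opprB.
  by rewrite opp_lfunE !semidirect_br_dualE opprB.
Qed.
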